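(* Each of the following Weihrauch problems is strongly Weihrauch equivalent to the others: $\mathsf{P}$, $\widehat{\mathsf{P}}$, $\mathsf{D}$, $\widehat{\mathsf{D}}$, and $\widehat{\mathsf{LPO}}$.
   Context: A Weihrauch problem is a set $\mathsf{C}\subseteq 2^\omega\times 2^\omega$ of instance/solution pairs. $\mathsf{Q}\le_{\mathrm{sW}}\mathsf{R}$ means there are Turing functionals $\Phi,\Psi$ such that for every instance $A$ of $\mathsf{Q}$, $\Phi(A)$ is an instance of $\mathsf{R}$ and for every solution $T$ of $\Phi(A)$, $\Psi(T)$ is a solution of $A$; strong Weihrauch equivalence is reducibility both ways. For a problem $\mathsf{Q}$, its infinite parallelization $\widehat{\mathsf{Q}}$ has as instances sequences $\langle A_i\rangle_{i\in\mathbb{N}}$ of instances of $\mathsf{Q}$ and as solutions sequences $\langle B_i\rangle_{i\in\mathbb{N}}$ with each $B_i$ a solution to $A_i$. $\mathsf{P}$: instance a countable graph $(V,E)$ ($V$ nonempty infinite subset of $\mathbb{N}$), solution a connected component (a set of vertices any two joined by a finite path, closed under path connectedness). $\mathsf{D}$: instance a countable graph, solution a decomposition, i.e. a map $f\colon V\to\mathbb{N}$ with $f(v_0)=f(v_1)$ iff $v_0,v_1$ are in the same connected component. $\mathsf{LPO}$ (limited principle of omniscience): instance a function $p\colon\mathbb{N}\to\mathbb{N}$, solution the correct answer to whether there exists $n$ with $p(n)=0$ (equivalently, for $\widehat{\mathsf{LPO}}$, given $\langle p_i\rangle$ the solution is the set $\{i:\exists n\,p_i(n)=0\}$). *)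

(* Defs.v *)
From mathcomp Require Import all_boot.
From Stdlib Require Import Cantor.

Set Implicit Arguments.
Unset Strict Implicit.
Unset Printing Implicit Defensive.

Definition cantor := nat -> bool.

(** * Turing functionals *)

(** Programs are Kleene's mu-recursive definitions with one additional initial
    function, the oracle. Arities are not tracked: a program is run on a list
    of arguments. *)
Inductive code : Type :=
| Zero
| Succ
| Proj (i : nat)
| Oracle
| Comp (f : code) (gs : seq code)
| Rec (f g : code)
| Mu (f : code).

(** [eval A c xs y]: with oracle [A], program [c] halts on [xs] with value [y].
    The recursion variable of [Rec] and the search variable of [Mu] are the
    first argument. In [eval_mu], [k] witnesses that the computations on all
    smaller candidates halt with a nonzero value. *)
Inductive eval (A : cantor) : code -> seq nat -> nat -> Prop :=
| eval_zero xs : eval A Zero xs 0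
| eval_succ x xs : eval A Succ (x :: xs) x.+1
| eval_proj i xs : eval A (Proj i) xs (nth 0 xs i)
| eval_oracle x xs : eval A Oracle (x :: xs) (A x)
| eval_comp f gs xs ys y :
    evals A gs xs ys -> eval A f ys y -> eval A (Comp f gs) xs y
| eval_rec0 f g xs y : eval A f xs y -> eval A (Rec f g) (0 :: xs) y
| eval_recS f g n xs r y :
    eval A (Rec f g) (n :: xs) r -> eval A g [:: n, r & xs] y ->
    eval A (Rec f g) (n.+1 :: xs) y
| eval_mu f xs y (k : nat -> nat) :
    (forall z, z < y -> eval A f (z :: xs) (k z).+1) ->
    eval A f (y :: xs) 0 -> eval A (Mu f) xs y
with evals (A : cantor) : seq code -> seq nat -> seq nat -> Prop :=
| evals_nil xs : evals A [::] xs [::]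
| evals_cons g gs xs y ys :
    eval A g xs y -> evals A gs xs ys -> evals A (g :: gs) xs (y :: ys).

(** The functional of index [e] is defined at [A] with value [B]; bits are read
    as the numbers 0 and 1. *)
Definition functional (e : code) (A B : cantor) : Prop :=
  forall n, eval A e [:: n] (B n).

(** * Weihrauch problems *)

(** The set of instance/solution pairs. *)
Definition problem := cantor -> cantor -> Prop.

Definition instance (Q : problem) (A : cantor) : Prop := exists B, Q A B.

Definition sW_reducible (Q R : problem) : Prop :=
  exists Phi Psi : code, forall A, instance Q A ->
    exists PhiA, [/\ functional Phi A PhiA, instance R PhiA &
      forall T, R PhiA T -> exists2 PsiT, functional Psi T PsiT & Q A PsiT].

Definition sW_equiv (Q R : problem) : Prop :=
  sW_reducible Q R /\ sW_reducible R Q.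

Definition code_pair (m n : nat) : nat := Cantor.to_nat (m, n).

(** A sequence of elements of Cantor space is coded by its columns. *)
Definition column (A : cantor) (i : nat) : cantor :=
  fun n => A (code_pair i n).

Definition parallelization (Q : problem) : problem :=
  fun A B => forall i, Q (column A i) (column B i).

(** * Graphs *)

(** A graph is coded by the join of its vertex set and its edge relation. *)
Definition vertex (A : cantor) (v : nat) : bool := A v.*2.

Definition edge (A : cantor) : rel nat :=
  fun u v => A (code_pair u v).*2.+1.

(** The first clause says that the vertex set is not covered by any finite
    list, i.e. is infinite (hence nonempty). *)
Definition is_graph (A : cantor) : Prop :=
  [/\ forall s : seq nat, exists2 v, vertex A v & v \notin s,
      forall u v, edge A u v -> vertex A u && vertex A v,
      symmetric (edge A) &
      irreflexive (edge A)].

Definition joined (A : cantor) (u w : nat) : Prop :=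
  exists2 p : seq nat, path (edge A) u p & last u p = w.

(** Without the first clause the empty set would be a connected component. *)
Definition is_component (A B : cantor) : Prop :=
  [/\ exists v, B v,
      forall v, B v -> vertex A v,
      forall u w, B u -> B w -> joined A u w &
      forall u w, B u -> joined A u w -> B w].

Definition P : problem := fun A B => is_graph A /\ is_component A B.

(** The values of [f] outside the vertex set are irrelevant. *)
Definition is_decomposition (A : cantor) (f : nat -> nat) : Prop :=
  forall v0 v1, vertex A v0 -> vertex A v1 -> (f v0 = f v1 <-> joined A v0 v1).

(** A decomposition is coded by its graph
    { (v, n) | v is a vertex and f v = n }. *)
Definition D : problem := fun A B =>
  is_graph A /\
  exists2 f, is_decomposition A f &
    forall v n, B (code_pair v n) = vertex A v && (f v == n).

(** * The limited principle of omniscience *)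

(** The instance [p] is coded by its graph, the answer by the subset of {0}
    that contains 0 exactly when [p] has a zero. *)
Definition LPO : problem := fun A B =>
  exists p : nat -> nat,
    [/\ forall n m, A (code_pair n m) = (p n == m),
        B 0 <-> exists n, p n = 0 &
        forall n, B n.+1 = false].

(* Main.v *)
(** Every solution of the parallelized problems is read off from the truth values
    of "u and w are joined in the i-th graph". These are existential statements,
    that is, existence of zeros of computable functions: one instance of
    the parallelization of LPO answers all of them.

    Conversely, from p_0, p_1, ... build a graph on the infinitely branching tree
    in which the i-th child of a node is joined to its parent exactly when p_i has
    a zero (an intermediate vertex stands for each zero, which keeps the edge
    relation computable). Every node x can serve as a base point: i is answered by
    asking whether the i-th child of x lies in the component of x. Hence an
    arbitrary component, and an arbitrary decomposition, decides all i uniformly. *)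

From Stdlib Require Import List.
Require Import Defs.
From mathcomp Require Import all_boot.
From mathcomp Require Import boolp.

Set Implicit Arguments.
Unset Strict Implicit.
Unset Printing Implicit Defensive.

(** * Composition of functionals *)

(** Each oracle call becomes a run of [e]. As arities are not tracked, a call may carry extra
    arguments; [Proj 0] keeps the query alone. *)
Fixpoint subst_oracle (e c : code) : code :=
  match c with
  | Oracle => Comp e [:: Proj 0]
  | Comp f gs => Comp (subst_oracle e f) (map (subst_oracle e) gs)
  | Rec f g => Rec (subst_oracle e f) (subst_oracle e g)
  | Mu f => Mu (subst_oracle e f)
  | _ => c
  end.

Scheme eval_evals_ind := Minimality for eval Sort Prop
with evals_eval_ind := Minimality for evals Sort Prop.

Lemma eval_subst_oracle (e : code) (A B : cantor) :
  functional e A B ->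
  forall c xs y, eval B c xs y -> eval A (subst_oracle e c) xs y.
Proof.
move=> eAB; apply: (@eval_evals_ind B
  (fun c xs y => eval A (subst_oracle e c) xs y)
  (fun gs xs ys => evals A (map (subst_oracle e) gs) xs ys)) => /=.
- by move=> xs; constructor.
- by move=> x xs; constructor.
- by move=> i xs; constructor.
- move=> x xs; apply: eval_comp (eAB x).
  by constructor; [exact: (eval_proj A 0 (x :: xs)) | constructor].
- by move=> f gs xs ys y _ + _; apply: eval_comp.
- by move=> f g xs y _ IH; constructor.
- by move=> f g n xs r y _ IHr _ IHy; apply: eval_recS IHr IHy.
- by move=> f xs y k _ IHk _ IHy; apply: eval_mu IHk IHy.
- by move=> xs; constructor.
- by move=> g gs xs y ys _ IHg _ IHgs; constructor.
Qed.

(** The forward program runs [F2] on the output of [F1]; the backward one runs [G1] on the output of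
    [G2]. *)
Lemma sW_trans (Q R S : problem) :
  sW_reducible Q R -> sW_reducible R S -> sW_reducible Q S.
Proof.
move=> [F1 [G1 QR]] [F2 [G2 RS]].
exists (subst_oracle F1 F2), (subst_oracle G2 G1) => A /QR[B [F1AB /RS]].
move=> [C [F2BC S_C SR]] RQ; exists C; split=> //.
  by move=> n; apply: eval_subst_oracle F1AB _ _ _ (F2BC n).
move=> T /SR[U G2TU /RQ[V G1UV QAV]]; exists V => //.
by move=> n; apply: eval_subst_oracle G2TU _ _ _ (G1UV n).
Qed.

(** * Computable functions *)

(** Arguments are read through an environment [nat -> nat] rather than a list,
    so that shifting variables under a binder is a definitional operation. *)
Definition computable (dom : cantor -> Prop) (n : nat)
    (F : cantor -> (nat -> nat) -> nat) : Prop :=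
  exists c, forall A xs, dom A -> size xs = n -> eval A c xs (F A (nth 0 xs)).

(** The value is 0 when [p] is empty. *)
Definition least (p : pred nat) : nat :=
  if pselect (exists n, p n) is left ex_p then ex_minn ex_p else 0.

Lemma leastP (p : pred nat) :
  (exists n, p n) -> p (least p) /\ forall n, p n -> least p <= n.
Proof.
by rewrite /least; case: pselect => // ex_p _; case: ex_minnP.
Qed.

Lemma least_eq (p : pred nat) m :
  p m -> (forall n, p n -> m <= n) -> least p = m.
Proof.
move=> pm min_m; have [|pl lmin] := @leastP p; first by exists m.
by apply/anti_leq; rewrite lmin // min_m.
Qed.

Section Computable.

Variables (dom : cantor -> Prop) (n : nat).

Implicit Types (F G H : cantor -> (nat -> nat) -> nat).

Lemma computable_ext F G :
  (forall A e, F A e = G A e) -> computable dom n F -> computable dom n G.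
Proof.
by move=> FG [c cF]; exists c => A xs dA nxs; rewrite -FG; apply: cF.
Qed.

Lemma computable_var i : computable dom n (fun _ e => e i).
Proof. by exists (Proj i) => A xs _ _; constructor. Qed.

(** With the environment written as [nth 0] of a literal list, the conclusion for a concrete [F] is
    convertible with plain substitution. *)
Lemma computable_comp1 F G :
  computable dom 1 F -> computable dom n G ->
  computable dom n (fun A e => F A (nth 0 [:: G A e])).
Proof.
move=> [c cF] [d dG]; exists (Comp c [:: d]) => A xs dA nxs.
apply: eval_comp (cF A [:: G A (nth 0 xs)] dA erefl).
by constructor; [exact: dG | constructor].
Qed.

Lemma computable_comp2 F G H :
  computable dom 2 F -> computable dom n G -> computable dom n H ->
  computable dom n (fun A e => F A (nth 0 [:: G A e; H A e])).
Proof.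
move=> [c cF] [d dG] [d' dH]; exists (Comp c [:: d; d']) => A xs dA nxs.
apply: eval_comp (cF A [:: G A (nth 0 xs); H A (nth 0 xs)] dA erefl).
constructor; first exact: dG.
by constructor; [exact: dH | constructor].
Qed.

Lemma computable_succ F :
  computable dom n F -> computable dom n (fun A e => (F A e).+1).
Proof.
move=> [c cF]; exists (Comp Succ [:: c]) => A xs dA nxs.
apply: eval_comp (eval_succ _ _ [::]).
by constructor; [exact: cF | constructor].
Qed.

Lemma computable_const k : computable dom n (fun _ _ => k).
Proof.
elim: k => [|k IHk]; last exact: computable_succ.
by exists Zero => A xs _ _; constructor.
Qed.

Lemma computable_oracle F :
  computable dom n F -> computable dom n (fun A e => A (F A e)).
Proof.
move=> [c cF]; exists (Comp Oracle [:: c]) => A xs dA nxs.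
apply: eval_comp (eval_oracle _ _ [::]).
by constructor; [exact: cF | constructor].
Qed.

(** Projections hand the parameters on to [Rec] unchanged; the prefix [ys] generalizes the starting
    index for the induction. *)
Lemma evals_proj A (ys xs : seq nat) :
  evals A [seq Proj i | i <- iota (size ys) (size xs)] (ys ++ xs) xs.
Proof.
elim: xs ys => [|x xs IH] ys /=; first by constructor.
constructor.
  by have := eval_proj A (size ys) (ys ++ x :: xs); rewrite nth_cat ltnn subnn.
by have := IH (rcons ys x); rewrite size_rcons cat_rcons.
Qed.

Lemma computable_rec F (g : cantor -> (nat -> nat) -> nat -> nat -> nat) H :
  computable dom n F ->
  computable dom n.+2 (fun A e => g A (fun i => e i.+2) (e 0) (e 1)) ->
  computable dom n H ->
  computable dom n (fun A e => nat_rec (fun _ => nat) (F A e) (g A e) (H A e)).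
Proof.
move=> [c cF] [d dg] [h hH].
exists (Comp (Rec c d) (h :: [seq Proj i | i <- iota 0 n])) => A xs dA nxs.
apply: (@eval_comp _ _ _ _ (H A (nth 0 xs) :: xs)).
  constructor; first exact: hH.
  by rewrite -nxs; apply: (evals_proj A [::]).
elim: (H A _) => [|k IHk] /=; first by constructor; apply: cF.
apply: eval_recS IHk _.
by apply: (dg A [:: k, _ & xs]) => //=; rewrite nxs.
Qed.

End Computable.

(** * Closure under arithmetic and Boolean operations *)

Section Arithmetic.

Variables (dom : cantor -> Prop) (n : nat).

Implicit Types (F G : cantor -> (nat -> nat) -> nat).

Lemma computable_add F G :
  computable dom n F -> computable dom n G ->
  computable dom n (fun A e => F A e + G A e).
Proof.
apply: (computable_comp2 (F := fun _ e => e 0 + e 1)).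
apply: computable_ext (computable_rec (g := fun _ _ _ r => r.+1)
  (computable_var dom 2 1) _ (computable_var dom 2 0)).
  by move=> A e /=; elim: (e 0) => [|k /= ->].
exact: computable_succ (computable_var _ _ _).
Qed.

Lemma computable_pred F :
  computable dom n F -> computable dom n (fun A e => (F A e).-1).
Proof.
apply: (computable_comp1 (F := fun _ e => (e 0).-1)).
apply: computable_ext (computable_rec (g := fun _ _ k _ => k)
  (computable_const dom 1 0) _ (computable_var dom 1 0)).
  by move=> A e /=; case: (e 0).
exact: computable_var.
Qed.

End Arithmetic.

Section Booleans.

Variables (dom : cantor -> Prop) (n : nat).

Implicit Types (F G H : cantor -> (nat -> nat) -> nat).
Implicit Types (a b : cantor -> (nat -> nat) -> bool).
Implicit Types (p : cantor -> (nat -> nat) -> nat -> bool).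

Lemma computable_sub F G :
  computable dom n F -> computable dom n G ->
  computable dom n (fun A e => F A e - G A e).
Proof.
apply: (computable_comp2 (F := fun _ e => e 0 - e 1)).
apply: computable_ext (computable_rec (g := fun _ _ _ r => r.-1)
  (computable_var dom 2 0) _ (computable_var dom 2 1)).
  by move=> A e /=; elim: (e 1) => [|k /= ->]; rewrite ?subn0 ?subnS.
exact: computable_pred (computable_var _ _ _).
Qed.

Lemma computable_lt F G :
  computable dom n F -> computable dom n G ->
  computable dom n (fun A e => F A e < G A e).
Proof.
move=> cF cG.
(* Truncated [1 - x] tests [x] for zero. *)
apply: computable_ext (computable_sub (computable_const _ _ 1)
  (computable_sub (computable_succ cF) cG)).
by move=> A e; rewrite -subn_eq0; case: ((F A e).+1 - _).
Qed.

Lemma computable_eq F G :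
  computable dom n F -> computable dom n G ->
  computable dom n (fun A e => F A e == G A e).
Proof.
move=> cF cG.
apply: computable_ext (computable_sub (computable_const _ _ 1)
  (computable_add (computable_sub cF cG) (computable_sub cG cF))).
move=> A e; rewrite eqn_leq -!subn_eq0.
by case: (F A e - _) => [|[|?]] //=; case: (G A e - _).
Qed.

Lemma computable_neg b :
  computable dom n b -> computable dom n (fun A e => ~~ b A e).
Proof.
move=> cb; apply: computable_ext (computable_sub (computable_const _ _ 1) cb).
by move=> A e; case: (b A e).
Qed.

Lemma computable_or a b :
  computable dom n a -> computable dom n b ->
  computable dom n (fun A e => a A e || b A e).
Proof.
move=> ca cb.
apply: computable_ext
  (computable_lt (computable_const _ _ 0) (computable_add ca cb)).
by move=> A e; case: (a A e) (b A e) => [] [].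
Qed.

Lemma computable_and a b :
  computable dom n a -> computable dom n b ->
  computable dom n (fun A e => a A e && b A e).
Proof.
move=> ca cb.
apply: computable_ext
  (computable_lt (computable_const _ _ 1) (computable_add ca cb)).
by move=> A e; case: (a A e) (b A e) => [] [].
Qed.

(** The body is computed in arity [n.+2] because the recursion also binds the
    accumulator; [e 1] is that accumulator. *)
Lemma computable_has p H :
  computable dom n.+2 (fun A e => p A (fun i => e i.+2) (e 0)) ->
  computable dom n H ->
  computable dom n (fun A e => has (p A e) (iota 0 (H A e))).
Proof.
move=> cp cH.
apply: computable_ext (computable_lt (computable_const _ _ 0)
  (computable_rec (g := fun A e k r => p A e k + r)
    (computable_const _ _ 0) _ cH)).
  move=> A e; elim: (H A e) => [|k IHk] //.
  rewrite -{2}(addn1 k) iotaD has_cat /= orbF addn_gt0.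
  by case: (p A e k); rewrite ?orbT ?orbF.
exact: computable_add cp (computable_var _ _ _).
Qed.

End Booleans.

(** Unbounded search halts only if a solution exists; restricting oracles to [dom] guarantees
    this. *)
Lemma computable_least dom n (p : cantor -> (nat -> nat) -> nat -> bool) :
  (forall A e, dom A -> exists y, p A e y) ->
  computable dom n.+1 (fun A e => p A (fun i => e i.+1) (e 0)) ->
  computable dom n (fun A e => least (p A e)).
Proof.
(* [Mu] looks for the value 0, hence the negation; each failed candidate then has value 1, the
   successor of 0. *)
move=> ex_p /computable_neg[d cd].
exists (Mu d) => A xs dA nxs.
have [pl lmin] := leastP (ex_p A (nth 0 xs) dA).
have ev z : eval A d (z :: xs) (~~ p A (nth 0 xs) z).
  by apply: (cd A (z :: xs)) => //=; rewrite nxs.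
apply: (@eval_mu _ _ _ _ (fun _ => 0)).
  move=> z; rewrite ltnNge => zl; have := ev z.
  by case pz: (p _ _ z) => //; rewrite lmin in zl.
by have := ev (least (p A (nth 0 xs))); rewrite pl.
Qed.

(** * The pairing function, its projections and coded walks *)

Definition left_part (z : nat) : nat := (Cantor.of_nat z).1.
Definition right_part (z : nat) : nat := (Cantor.of_nat z).2.

Lemma left_pair x y : left_part (code_pair x y) = x.
Proof. by rewrite /left_part /code_pair Cantor.cancel_of_to. Qed.

Lemma right_pair x y : right_part (code_pair x y) = y.
Proof. by rewrite /right_part /code_pair Cantor.cancel_of_to. Qed.

Lemma code_pairK z : code_pair (left_part z) (right_part z) = z.
Proof.
rewrite /left_part /right_part /code_pair -surjective_pairing.
exact: Cantor.cancel_to_of.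
Qed.

Lemma code_pair_inj x y x' y' :
  code_pair x y = code_pair x' y' -> x = x' /\ y = y'.
Proof.
move=> /[dup] /(congr1 left_part) + /(congr1 right_part).
by rewrite !left_pair !right_pair.
Qed.

Lemma leq_code_pair x y : x + y <= code_pair x y.
Proof. by apply/leP; rewrite addnC; apply: Cantor.to_nat_non_decreasing. Qed.

Section Pairing.

Variables (dom : cantor -> Prop) (n : nat).

Implicit Types (F G : cantor -> (nat -> nat) -> nat).

Lemma computable_pair F G :
  computable dom n F -> computable dom n G ->
  computable dom n (fun A e => code_pair (F A e) (G A e)).
Proof.
apply: (computable_comp2 (F := fun _ e => code_pair (e 0) (e 1))).
(* By definition the code of [(x, y)] is [y] plus the triangular number of [y + x]. *)
apply: computable_ext (computable_add (computable_var _ _ 1)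
  (computable_rec (g := fun _ _ k r => k.+1 + r) (computable_const _ _ 0) _
    (computable_add (computable_var _ _ 1) (computable_var _ _ 0)))).
  by [].
exact: computable_add (computable_succ (computable_var _ _ _))
  (computable_var _ _ _).
Qed.

End Pairing.

Lemma computable_left dom n (F : cantor -> (nat -> nat) -> nat) :
  computable dom n F -> computable dom n (fun A e => left_part (F A e)).
Proof.
apply: (computable_comp1 (F := fun _ e => left_part (e 0))).
(* The left part is the only [x] that some [y] completes to the code; [y] is at most the code, so
   the inner search is bounded. *)
pose p (_ : cantor) (e : nat -> nat) x :=
  has (fun y => code_pair x y == e 0) (iota 0 (e 0).+1).
have pP A e x : reflect (left_part (e 0) = x) (p A e x).
  apply: (iffP hasP) => [[y _ /eqP<-]|<-]; first by rewrite left_pair.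
  exists (right_part (e 0)); rewrite ?code_pairK // mem_iota /= ltnS.
  by rewrite -[leqRHS]code_pairK (leq_trans (leq_addl _ _) (leq_code_pair _ _)).
apply: (@computable_ext _ _ (fun A e => least (p A e))).
  by move=> A e; apply: least_eq => [|x]; [apply/pP | move/pP=> <-].
apply: computable_least.
  by move=> A e _; exists (left_part (e 0)); apply/pP.
apply: computable_has; last exact: computable_succ (computable_var _ _ _).
apply: computable_eq; last exact: computable_var.
by apply: computable_pair; apply: computable_var.
Qed.

Lemma computable_right dom n (F : cantor -> (nat -> nat) -> nat) :
  computable dom n F -> computable dom n (fun A e => right_part (F A e)).
Proof.
apply: (computable_comp1 (F := fun _ e => right_part (e 0))).
pose p (_ : cantor) (e : nat -> nat) y := code_pair (left_part (e 0)) y == e 0.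
have pP A e y : reflect (right_part (e 0) = y) (p A e y).
  apply: (iffP eqP) => [<-|<-]; last exact: code_pairK.
  by rewrite right_pair.
apply: (@computable_ext _ _ (fun A e => least (p A e))).
  by move=> A e; apply: least_eq => [|y]; [apply/pP | move/pP=> <-].
apply: computable_least.
  by move=> A e _; exists (right_part (e 0)); apply/pP.
apply: computable_eq; last exact: computable_var.
apply: computable_pair; last exact: computable_var.
exact: computable_left (computable_var _ _ _).
Qed.

Section Division.

Variables (dom : cantor -> Prop) (n : nat).

Implicit Types (F : cantor -> (nat -> nat) -> nat).

Lemma computable_double F :
  computable dom n F -> computable dom n (fun A e => (F A e).*2).
Proof.
move=> cF; apply: computable_ext (computable_add cF cF) => A e.
exact: addnn.
Qed.

Lemma computable_odd F :
  computable dom n F -> computable dom n (fun A e => odd (F A e)).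
Proof.
move=> cF; apply: computable_ext (computable_rec
  (g := fun _ _ _ r => (r == 0)) (computable_const _ _ 0) _ cF).
  by move=> A e; elim: (F A e) => [|k /= ->] //; case: odd.
exact: computable_eq (computable_var _ _ _) (computable_const _ _ _).
Qed.

End Division.

Lemma computable_half dom n (F : cantor -> (nat -> nat) -> nat) :
  computable dom n F -> computable dom n (fun A e => (F A e)./2).
Proof.
(* Half of [m] is the number of odd numbers below [m]. *)
move=> cF; apply: computable_ext (computable_rec
  (g := fun _ _ k r => odd k + r) (computable_const _ _ 0) _ cF).
  by move=> A e; elim: (F A e) => [|k /= ->] //; rewrite uphalf_half.
apply: computable_add (computable_var _ _ _).
exact: computable_odd (computable_var _ _ _).
Qed.

(** The element of index [k] of the infinite sequence coded by [s] as nested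
    pairs. *)
Definition walk (s k : nat) : nat := left_part (iter k right_part s).

Lemma walk_pair0 x s : walk (code_pair x s) 0 = x.
Proof. exact: left_pair. Qed.

Lemma walk_pairS x s k : walk (code_pair x s) k.+1 = walk s k.
Proof. by rewrite /walk iterSr right_pair. Qed.

Lemma walk_seq (l : seq nat) :
  exists s, forall k, k < size l -> walk s k = nth 0 l k.
Proof.
elim: l => [|x l [s IHs]]; first by exists 0.
exists (code_pair x s) => -[_|k]; first exact: walk_pair0.
by rewrite walk_pairS => /IHs.
Qed.

Lemma computable_walk dom n (F G : cantor -> (nat -> nat) -> nat) :
  computable dom n F -> computable dom n G ->
  computable dom n (fun A e => walk (F A e) (G A e)).
Proof.
move=> cF cG; apply: computable_left.
apply: computable_ext
  (computable_rec (g := fun _ _ _ r => right_part r) cF _ cG).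
  by move=> A e; elim: (G A e) => [|k /= ->].
exact: computable_right (computable_var _ _ _).
Qed.

(* Unification may unfold [walk] to [left_part], [code_pair] to a successor and
   [<] to [==], so the order of the lemmas matters. *)
Ltac computability := repeat first
  [ exact: computable_var | exact: computable_const
  | apply: computable_walk | apply: computable_pair | apply: computable_left
  | apply: computable_right | apply: computable_double | apply: computable_half
  | apply: computable_succ | apply: computable_pred
  | apply: computable_or | apply: computable_and | apply: computable_neg
  | apply: computable_lt | apply: computable_eq | apply: computable_odd
  | apply: computable_has | apply: computable_oracle ].

(** The backward map may use unbounded search, so it need only be computable on a set [dom]
    containing the solutions that occur. *)
Lemma sW_reducible_intro (Q R : problem) (F G : cantor -> cantor)
    (dom : cantor -> Prop) :
  computable (fun=> True) 1 (fun A e => F A (e 0)) ->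
  computable dom 1 (fun T e => G T (e 0)) ->
  (forall A, instance Q A -> instance R (F A)) ->
  (forall A T, instance Q A -> R (F A) T -> dom T /\ Q A (G T)) ->
  sW_reducible Q R.
Proof.
move=> [Phi PhiP] [Psi PsiP] QR RQ; exists Phi, Psi => A QA.
exists (F A); split; [by move=> k; apply: (PhiP A [:: k]) | exact: QR |].
move=> T /(RQ _ _ QA)[domT QAG]; exists (G T) => // k.
exact: (PsiP T [:: k]).
Qed.

(** * Graphs *)

Lemma joined_refl A u : joined A u u.
Proof. by exists [::]. Qed.

Lemma joined_trans A u v w : joined A u v -> joined A v w -> joined A u w.
Proof.
move=> [p pP <-] [q qP <-]; exists (p ++ q); last by rewrite last_cat.
by rewrite cat_path pP.
Qed.

Lemma joined_edge A u v : edge A u v -> joined A u v.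
Proof. by move=> uv; exists [:: v] => //=; rewrite uv. Qed.

Lemma joined_ind A (I : nat -> Prop) :
  (forall u v, edge A u v -> I u -> I v) ->
  forall u w, joined A u w -> I u -> I w.
Proof.
move=> edgeI u w [p + <-]; elim: p u => //= v p IHp u /andP[uv pP] Iu.
exact: IHp pP (edgeI _ _ uv Iu).
Qed.

Lemma joined_sym A u w : symmetric (edge A) -> joined A u w -> joined A w u.
Proof.
move=> symA uw.
apply: (@joined_ind A (fun x => joined A x u) _ u w uw (joined_refl A u)).
move=> v v' vv' vu; apply: joined_trans vu.
by apply: joined_edge; rewrite symA.
Qed.

Lemma joined_vertex A u w :
  is_graph A -> joined A u w -> vertex A u -> vertex A w.
Proof.
move=> [_ eV _ _] uw Vu; apply: (@joined_ind A (vertex A) _ u w uw Vu).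
by move=> x y /eV/andP[].
Qed.

Lemma P_instance A : is_graph A -> instance P A.
Proof.
move=> gA; have [infV _ symA _] := gA; have [v Vv _] := infV [::].
exists (fun w => `[< joined A v w >]); split=> //; split.
- by exists v; apply/asboolP/joined_refl.
- by move=> w /asboolP/(joined_vertex gA); apply.
- by move=> u w /asboolP/(joined_sym symA) uv /asboolP; apply: joined_trans.
- move=> u w /asboolP vu uw; apply/asboolP; exact: joined_trans vu uw.
Qed.

(** A canonical decomposition: once joinedness is decided, its graph is decidable by bounded
    search. *)
Definition least_joined (A : cantor) (v : nat) : nat :=
  least (fun u => `[< joined A u v >]).

Lemma least_joinedP A v :
  joined A (least_joined A v) v /\
  forall u, joined A u v -> least_joined A v <= u.
Proof.
have [|/asboolP lv lmin] := @leastP (fun u => `[< joined A u v >]).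
  by exists v; apply/asboolP/joined_refl.
by split=> // u /asboolP/lmin.
Qed.

Lemma least_joined_decomposition A :
  is_graph A -> is_decomposition A (least_joined A).
Proof.
move=> [_ _ symA _] v w _ _.
have joinedV x := (least_joinedP A x).1.
split=> [vw|vw].
  by apply: joined_trans (joinedV w); rewrite -vw; apply: joined_sym.
congr least; apply/funext => u; apply: asbool_equiv_eq; split=> [uv|uw].
  exact: joined_trans uv vw.
by apply: joined_trans uw _; apply: joined_sym.
Qed.

Lemma D_instance A : is_graph A -> instance D A.
Proof.
move=> gA; exists (fun z => vertex A (left_part z) &&
  (least_joined A (left_part z) == right_part z)).
split=> //; exists (least_joined A); first exact: least_joined_decomposition.
by move=> v n; rewrite left_pair right_pair.
Qed.

Lemma hatLPO_instance (p : nat -> nat -> nat) :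
  instance (parallelization LPO) (fun z =>
    p (left_part z) (left_part (right_part z)) == right_part (right_part z)).
Proof.
exists (fun z => (right_part z == 0) && `[< exists n, p (left_part z) n = 0 >]).
move=> i; exists (p i); rewrite /column; split.
- by move=> n m; rewrite right_pair !left_pair right_pair.
- by rewrite right_pair left_pair /=; split=> /asboolP.
- by move=> n; rewrite right_pair.
Qed.

(** * Reducing components and decompositions to the halting questions *)

(** [n] codes a walk of length [left_part n] from [u] to [w] in the [i]-th graph. *)
Definition witness (A : cantor) (i u w n : nat) : bool :=
  [&& vertex (column A i) u, vertex (column A i) w, walk (right_part n) 0 == u,
      walk (right_part n) (left_part n) == w &
      ~~ has (fun k => ~~ edge (column A i) (walk (right_part n) k)
                                            (walk (right_part n) k.+1))
             (iota 0 (left_part n))].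

(** The vertex tests matter because a walk of length 0 joins any number to itself. The edge
    condition is a negated [has], the form that [computable_has] handles. *)
Lemma witnessP A i u w :
  (exists n, witness A i u w n) <->
  [/\ vertex (column A i) u, vertex (column A i) w & joined (column A i) u w].
Proof.
split=> [[n /and5P[-> -> /eqP su /eqP sw /hasPn sE]]|[Vu Vw [p pP lp]]].
  split=> //; set s := right_part n in su sw sE; set L := left_part n in sw sE.
  have nth_walk k :
      k <= L -> nth 0 (u :: mkseq (fun k => walk s k.+1) L) k = walk s k.
    by case: k => [_|k kL] /=; rewrite ?su ?nth_mkseq.
  exists (mkseq (fun k => walk s k.+1) L).
    apply/(pathP 0) => k; rewrite size_mkseq => kL.
    rewrite nth_walk ?(ltnW kL) // nth_mkseq //; apply/negPn/sE.
    by rewrite mem_iota.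
  by rewrite (last_nth 0) size_mkseq nth_walk.
have [s sP] := walk_seq (u :: p); exists (code_pair (size p) s).
rewrite /witness Vu Vw left_pair right_pair !sP //=.
rewrite eqxx -lp (last_nth 0) eqxx /=.
apply/hasPn => k; rewrite mem_iota /= add0n => kp; rewrite negbK.
by rewrite !sP ?ltnS ?(ltnW kp) //; move/(pathP 0): pP => /(_ k kp).
Qed.

Definition query (i u w : nat) : nat := code_pair i (code_pair u w).

(** Column [query i u w] is the graph of the function with value 0 at witnesses and 1 elsewhere. *)
Definition joined_queries (A : cantor) : cantor := fun z =>
  ~~ witness A (left_part (left_part z)) (left_part (right_part (left_part z)))
       (right_part (right_part (left_part z))) (left_part (right_part z))
    == right_part (right_part z) :> nat.

Lemma computable_joined_queries dom :
  computable dom 1 (fun A e => joined_queries A (e 0)).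
Proof.
by rewrite /joined_queries /witness /vertex /edge /column; computability.
Qed.

Lemma joined_queries_instance A :
  instance (parallelization LPO) (joined_queries A).
Proof.
exact: (hatLPO_instance (fun j n => nat_of_bool (~~ witness A (left_part j)
  (left_part (right_part j)) (right_part (right_part j)) n))).
Qed.

Lemma joined_queries_solution A T i u w :
  parallelization LPO (joined_queries A) T ->
  T (code_pair (query i u w) 0) <->
  [/\ vertex (column A i) u, vertex (column A i) w & joined (column A i) u w].
Proof.
move=> /(_ (query i u w))[p [pP TP _]]; rewrite -witnessP.
have p0 n : p n = 0 <-> witness A i u w n.
  have := pP n 0; rewrite /column /joined_queries /query.
  rewrite !(left_pair, right_pair).
  by case: witness => /= /esym/eqP; split.
by rewrite TP; split=> -[n] /p0; exists n.
Qed.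

(** In each graph the component of the least vertex is returned. The query [(i, v, v)] decides
    whether [v] is a vertex, and the search for one ends because graphs are nonempty. *)
Lemma hatP_hatLPO : sW_reducible (parallelization P) (parallelization LPO).
Proof.
pose base T i := least (fun v => T (code_pair (query i v v) 0)).
pose G (T : cantor) : cantor := fun z =>
  T (code_pair (query (left_part z) (base T (left_part z)) (right_part z)) 0).
pose dom (T : cantor) := forall i, exists v, T (code_pair (query i v v) 0).
apply: (sW_reducible_intro (G := G) (dom := dom) (computable_joined_queries _)).
- rewrite /G /query; computability.
  by apply: computable_least; [move=> T e; apply | computability].
- by move=> A _; apply: joined_queries_instance.
move=> A T [B PB] LT.
have TP i u w := joined_queries_solution i u w LT.
have domT : dom T.
  move=> i; have [[infV _ _ _] _] := PB i; have [v Vv _] := infV [::].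
  by exists v; apply/TP; split=> //; apply: joined_refl.
split=> // i; have [gA _] := PB i; split=> //.
have [_ _ symA _] := gA.
have [/TP[Vb _ _] _] := leastP (domT i).
have GP w : column (G T) i w <-> joined (column A i) (base T i) w.
  rewrite /column /G left_pair right_pair TP; split=> [[]//|bw].
  by split=> //; apply: joined_vertex bw Vb.
split.
- by exists (base T i); apply/GP/joined_refl.
- by move=> w /GP/(joined_vertex gA); apply.
- by move=> u w /GP/(joined_sym symA) ub /GP; apply: joined_trans.
- by move=> u w /GP bu uw; apply/GP/joined_trans/uw.
Qed.

(** The label of [v] is [n] when [n] is joined to [v] and no smaller number is. All queries fail at
    a non-vertex, as the coding of decompositions demands. *)
Lemma hatD_hatLPO : sW_reducible (parallelization D) (parallelization LPO).
Proof.
pose G (T : cantor) : cantor := fun z =>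
  let q m := T (code_pair (query (left_part z) m (left_part (right_part z))) 0) in
  q (right_part (right_part z)) && ~~ has q (iota 0 (right_part (right_part z))).
apply: (sW_reducible_intro (G := G) (dom := fun=> True)
  (computable_joined_queries _)).
- by rewrite /G /query; computability.
- by move=> A _; apply: joined_queries_instance.
move=> A T [B DB] LT; split=> // i.
have TP u w := joined_queries_solution i u w LT.
have [gA _] := DB i; split=> //.
exists (least_joined (column A i)); first exact: least_joined_decomposition.
move=> v n; rewrite /column /G !(left_pair, right_pair) -/(column A i).
have [Vv|nVv] := boolP (vertex (column A i) v); last first.
  by apply/negbTE; apply: contra nVv => /andP[/TP[]].
have [_ _ symA _] := gA.
have q_joined m : T (code_pair (query i m v) 0) <-> joined (column A i) m v.
  split=> [/TP[]//|mv]; apply/TP; split=> //.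
  exact: joined_vertex (joined_sym symA mv) Vv.
have [lv lmin] := least_joinedP (column A i) v.
apply/andP/eqP => [[/q_joined/lmin ln /hasPn min_n]|<-].
  apply/anti_leq; rewrite ln leqNgt; apply/negP => l_lt_n.
  have := min_n (least_joined (column A i) v).
  by rewrite mem_iota l_lt_n => /(_ isT)/negP[]; apply/q_joined.
split; first exact/q_joined.
apply/hasPn => m; rewrite mem_iota add0n /= ltnNge; apply: contra.
by move/q_joined/lmin.
Qed.

(** The instance is repeated in every column, and column 0 of the solution is returned. *)
Lemma parallelization_ge (Q : problem) : sW_reducible Q (parallelization Q).
Proof.
apply: (sW_reducible_intro (F := fun A z => A (right_part z))
  (G := fun T z => T (code_pair 0 z)) (dom := fun=> True)).
- by computability.
- by computability.
- move=> A [B QAB]; exists (fun z => B (right_part z)) => i.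
  have colK (C : cantor) : column (fun z => C (right_part z)) i = C.
    by apply/funext => k; rewrite /column right_pair.
  by rewrite !colK.
move=> A T _ /(_ 0); split=> //.
have <- // : column (fun z => A (right_part z)) 0 = A.
by apply/funext => k; rewrite /column right_pair.
Qed.

(** * Coding zeros into every component *)

(** The naturals are the nodes of a tree with root 0 in which [child x i] is the
    [i]-th child of [x]. The vertex [code_pair x n] belongs to the node [x]; it is
    adjacent to the hub [code_pair x 0], and, if [x] is an [i]-th child and [p_i]
    vanishes at [n], to the hub of the parent of [x]. *)
Definition child (x i : nat) : nat := (code_pair x i).+1.
Definition hub (x : nat) : nat := code_pair x 0.

(** Adjacency directed towards the hub [v]. The test [0 < n] excludes a loop at a hub, [x.-1]
    decodes a child into parent and index, and the bit of [A] says that the function of that index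
    vanishes at [n]. *)
Definition spoke (A : cantor) (u v : nat) : bool :=
  let x := left_part u in let n := right_part u in
  (right_part v == 0) &&
  ((x == left_part v) && (0 < n)
   || [&& 0 < x, left_part x.-1 == left_part v &
          A (code_pair (right_part x.-1) (code_pair n 0))]).

Definition tree_graph (A : cantor) : cantor := fun z =>
  [|| ~~ odd z, spoke A (left_part z./2) (right_part z./2) |
      spoke A (right_part z./2) (left_part z./2)].

Lemma computable_tree_graph dom :
  computable dom 1 (fun A e => tree_graph A (e 0)).
Proof. by rewrite /tree_graph /spoke; computability. Qed.

Section TreeGraph.

Variable A : cantor.

Lemma edge_tree u v : edge (tree_graph A) u v = spoke A u v || spoke A v u.
Proof.
by rewrite /edge /tree_graph /= odd_double uphalf_double left_pair right_pair.
Qed.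

Lemma vertex_tree v : vertex (tree_graph A) v.
Proof. by rewrite /vertex /tree_graph odd_double. Qed.

Lemma left_part_leq z : left_part z <= z.
Proof.
by rewrite -[leqRHS]code_pairK (leq_trans (leq_addr _ _) (leq_code_pair _ _)).
Qed.

Lemma tree_is_graph : is_graph (tree_graph A).
Proof.
(* The successor of the sum exceeds every element of [s]. *)
split=> [s|u v _|u v|u]; first exists (\sum_(x <- s) x).+1.
- exact: vertex_tree.
- apply/negP => /(big_rem _) sum_s; have := leqnn (\sum_(x <- s) x).
  by rewrite {1}sum_s /= addSn ltnNge leq_addr.
- by rewrite !vertex_tree.
- by rewrite !edge_tree orbC.
rewrite edge_tree orbb /spoke.
apply/negP => /andP[/eqP->]; rewrite ltnn andbF /=.
(* A loop would make a node its own parent, but parents have smaller numbers. *)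
case: (left_part u) => //= x /andP[/eqP xE _].
by have := left_part_leq x; rewrite xE ltnn.
Qed.

Inductive below (c : nat) : nat -> Prop :=
| below_refl : below c c
| below_child x i : below c x -> below c (child x i).

Lemma below_geq c x : below c x -> c <= x.
Proof.
elim=> // y i _ cy; apply: leq_trans cy (leqW _).
exact: leq_trans (leq_addr _ _) (leq_code_pair _ _).
Qed.

(** A spoke stays within a node or leads to the parent, so the subtree of [child x i] can only be
    left from its top, and this takes a zero of the [i]-th function. *)
Lemma spoke_below x i u v :
  ~ (exists n, A (code_pair i (code_pair n 0))) -> spoke A u v ->
  below (child x i) (left_part u) <-> below (child x i) (left_part v).
Proof.
move=> no_zero /andP[_ /orP[/andP[/eqP-> //]|]].
case: (left_part u) => //= l /andP[/eqP <-].
rewrite -{2}[l]code_pairK -/(child _ _) => zero; split; last exact: below_child.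
(* A child in the subtree is either its top, which yields the excluded zero, or the child of a node
   in it. *)
move El : (child (left_part l) _) => l' bl'.
case: bl' El => [[/code_pair_inj[_ iE]]|y j by_ [/code_pair_inj[-> //]]].
by case: no_zero; exists (right_part u); rewrite -iE.
Qed.

Lemma tree_joined_hub x n : joined (tree_graph A) (code_pair x n) (hub x).
Proof.
case: n => [|n]; first exact: joined_refl.
apply: joined_edge; rewrite edge_tree /spoke /hub !(left_pair, right_pair).
by rewrite !eqxx.
Qed.

(** A zero [n] makes the vertex [n] of the child a link between both hubs. Without a zero the
    subtree of the child is closed under edges, and it misses [x], whose number is smaller. *)
Lemma tree_joined_child x i :
  joined (tree_graph A) (hub x) (hub (child x i)) <->
  exists n, A (code_pair i (code_pair n 0)).
Proof.
have [_ _ symG _] := tree_is_graph.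
split=> [xc|[n An]]; last first.
  apply: joined_trans (tree_joined_hub (child x i) n).
  apply/(joined_sym symG)/joined_edge.
  rewrite edge_tree /spoke /hub /child !(left_pair, right_pair) /=.
  by rewrite eqxx An orbT.
apply: contrapT => no_zero.
have : below (child x i) (left_part (hub x)).
  apply: (@joined_ind _ (fun v => below (child x i) (left_part v)) _
    _ _ (joined_sym symG xc)); last by rewrite left_pair; constructor.
  by move=> u v; rewrite edge_tree => /orP[] /(spoke_below x no_zero)[].
move=> /below_geq; rewrite left_pair leqNgt ltnS.
by rewrite (leq_trans (leq_addr i x) (leq_code_pair x i)).
Qed.

End TreeGraph.

(** The given solution [B] supplies the functions whose graphs [A] codes. *)
Lemma hatLPO_solution (A B S : cantor) :
  parallelization LPO A B ->
  (forall i, S (code_pair i 0) <-> exists n, A (code_pair i (code_pair n 0))) ->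
  (forall i n, S (code_pair i n.+1) = false) ->
  parallelization LPO A S.
Proof.
move=> LAB S0 SS i; have [p [pA _ _]] := LAB i.
exists p; split=> [//||n]; last exact: SS.
rewrite /column S0; split=> -[n zero_n]; exists n.
  by apply/eqP; rewrite -pA.
by have := pA n 0; rewrite /column zero_n eqxx.
Qed.

Lemma hatLPO_P : sW_reducible (parallelization LPO) P.
Proof.
pose root (T : cantor) := least (fun x => T (hub x)).
apply: (sW_reducible_intro (F := tree_graph)
  (G := fun T z => (right_part z == 0) && T (hub (child (root T) (left_part z))))
  (dom := fun T => exists x, T (hub x)) (computable_tree_graph _)).
- rewrite /hub /child; computability.
  by apply: computable_least; [| computability].
- by move=> A _; apply/P_instance/tree_is_graph.
move=> A T [B LAB] [_ [[v Tv] _ Tjoined Tclosed]].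
(* The search for [root] ends: a component contains, with any vertex, the hub of its node. *)
have Thub : exists x, T (hub x).
  exists (left_part v); apply: Tclosed Tv _.
  by rewrite -{1}[v]code_pairK; apply: tree_joined_hub.
split=> //; have [Troot _] := leastP Thub.
apply: hatLPO_solution LAB _ _ => [i|i n]; rewrite !right_pair //= left_pair.
rewrite -(tree_joined_child A (root T)).
by split=> [|]; [apply: Tjoined | apply: Tclosed].
Qed.

(** Node 0 is the base point: the label of its hub is found by search and compared with those of the
    hubs of its children. *)
Lemma hatLPO_D : sW_reducible (parallelization LPO) D.
Proof.
pose label (T : cantor) := least (fun n => T (code_pair (hub 0) n)).
apply: (sW_reducible_intro (F := tree_graph)
  (G := fun T z => (right_part z == 0) &&
     T (code_pair (hub (child 0 (left_part z))) (label T)))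
  (dom := fun T => exists n, T (code_pair (hub 0) n)) (computable_tree_graph _)).
- rewrite /hub /child; computability.
  by apply: computable_least; [| computability].
- by move=> A _; apply/D_instance/tree_is_graph.
move=> A T [B LAB] [_ [f fP TP]].
have Tf v n : T (code_pair v n) = (f v == n) by rewrite TP vertex_tree.
have Tlabel : label T = f (hub 0).
  by apply: least_eq => [|n]; rewrite Tf // => /eqP->.
split; first by exists (f (hub 0)); rewrite Tf.
apply: hatLPO_solution LAB _ _ => [i|i n]; rewrite !right_pair //= left_pair.
rewrite Tf Tlabel -(tree_joined_child A 0) -fP ?vertex_tree //.
by split=> [/eqP/esym|->].
Qed.

Theorem theorem6p4 (Q R : problem)
  (hQ : List.In Q (P :: parallelization P :: D :: parallelization D
                     :: parallelization LPO :: nil))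
  (hR : List.In R (P :: parallelization P :: D :: parallelization D
                     :: parallelization LPO :: nil)) :
  sW_equiv Q R.
Proof.
pose L := parallelization LPO.
(* Each problem is compared with [L] only; for [L] itself, reflexivity comes from the detour through
   [parallelization P]. *)
have equivL X : List.In X (P :: parallelization P :: D :: parallelization D
    :: L :: nil) -> sW_reducible X L /\ sW_reducible L X.
  have LhatP := sW_trans hatLPO_P (parallelization_ge P).
  have LhatD := sW_trans hatLPO_D (parallelization_ge D).
  case=> [<-|[<-|[<-|[<-|[<-|[]]]]]]; split=> //.
  - exact: sW_trans (parallelization_ge P) hatP_hatLPO.
  - exact: hatLPO_P.
  - exact: hatP_hatLPO.
  - exact: sW_trans (parallelization_ge D) hatD_hatLPO.
  - exact: hatLPO_D.
  - exact: hatD_hatLPO.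
  - exact: sW_trans LhatP hatP_hatLPO.
  - exact: sW_trans LhatP hatP_hatLPO.
have [QL LQ] := equivL Q hQ; have [RL LR] := equivL R hR.
by split; [exact: sW_trans QL LR | exact: sW_trans RL LQ].
Qed.
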